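(* Let $k_n\in\mathbb{N}$ for all $n\in\mathbb{N}$, let $\{\zeta_{n,k}:1\le k\le k_n,\ n\in\mathbb{N}\}$ be non-negative integer-valued random variables with factorial moments $m_{n,k,j}:=\mathsf{E}\zeta_{n,k}(\zeta_{n,k}-1)\cdots(\zeta_{n,k}-j+1)$, $j\in\mathbb{N}$, and let $p_{n,k}\in[0,1]$ for $1\le k\le k_n$, $n\in\mathbb{N}$. Assume that, as $n\to\infty$, (i) $\sum_{k=1}^{k_n}p_{n,k}^j\,m_{n,k,j}\to\lambda_j\in[0,\infty)$ for all $j\in\mathbb{N}$, such that the limits (sums of infinite series, understood as limits of partial sums) $$\mu\{j\}:=\frac{1}{j!}\sum_{i=0}^{\infty}\frac{(-1)^i}{i!}\lambda_{j+i},\qquad j\in\mathbb{N},$$ exist; (ii) $\sum_{k=1}^{k_n}(p_{n,k}\,\mathsf{E}\zeta_{n,k})^2\to 0$. Then the convolution $\mathrm{Bi}(\mathcal{L}(\zeta_{n,1}),p_{n,1})*\cdots*\mathrm{Bi}(\mathcal{L}(\zeta_{n,k_n}),p_{n,k_n})$ converges weakly to $\mathrm{CP}(\mu)$ as $n\to\infty$ (the assertion includes that $\mu$ is a finite measure on $\mathbb{N}$, so that $\mathrm{CP}(\mu)$ is defined).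
   Context: $\mathcal{L}(\zeta)$ denotes the distribution of a random variable $\zeta$, and $*$ denotes convolution of probability measures. For a probability measure $\nu$ on $\mathbb{Z}_+$ and $p\in[0,1]$, the mixture of binomial distributions $\mathrm{Bi}(\nu,p)$ is the probability measure on $\mathbb{Z}_+$ given by $\mathrm{Bi}(\nu,p)\{j\}:=\sum_{\ell=j}^\infty\binom{\ell}{j}p^j(1-p)^{\ell-j}\nu\{\ell\}$, $j\in\mathbb{Z}_+$ (with $0^0=1$). For a finite measure $\mu$ on $\mathbb{Z}_+$ (a measure on $\mathbb{N}$ being extended by $0$), the compound Poisson distribution $\mathrm{CP}(\mu)$ with intensity measure $\mu$ is the probability measure on $\mathbb{Z}_+$ with generating function $z\mapsto\exp\{\sum_{j=1}^\infty\mu\{j\}(z^j-1)\}$ for $z\in\mathbb{C}$, $|z|\le 1$. *)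

(* Defs.v *)
From HB Require Import structures.
From mathcomp Require Import all_boot all_order all_algebra.
From mathcomp Require Import all_classical all_reals all_analysis.
From mathcomp Require Import complex.

Set Implicit Arguments.
Unset Strict Implicit.
Unset Printing Implicit Defensive.

Import Order.TTheory GRing.Theory Num.Theory.
Import numFieldNormedType.Exports.
Local Open Scope classical_set_scope.
Local Open Scope ring_scope.

Section mixed_binomial.
Context {R : realType}.
Local Open Scope ereal_scope.
Implicit Types (nu : probability nat R) (p : {i01 R}).

Definition mixed_binomial_pmf nu p (j : nat) : \bar R :=
  \sum_(j <= l <oo) (binomial_pmf l p%:num j)%:E * nu [set l].

(* The law Bi(nu, p). *)
Definition mixed_binomial nu p : set nat -> \bar R :=
  fun U => \esum_(j in U) mixed_binomial_pmf nu p j.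

Let pmf_term_ge0 nu p l j : 0 <= (binomial_pmf l p%:num j)%:E * nu [set l].
Proof.
by rewrite mule_ge0// lee_fin binomial_pmf_ge0//; apply/andP; split.
Qed.

Let mixed_binomial_pmf_ge0 nu p j : 0 <= mixed_binomial_pmf nu p j.
Proof. exact: nneseries_ge0. Qed.

Lemma mixed_binomial_set1 nu p j :
  mixed_binomial nu p [set j] = mixed_binomial_pmf nu p j.
Proof. by rewrite /mixed_binomial esum_set1. Qed.

Let mixed_binomial0 nu p : mixed_binomial nu p set0 = 0.
Proof. exact: esum_set0. Qed.

Let mixed_binomial_ge0 nu p U : 0 <= mixed_binomial nu p U.
Proof. exact: esum_ge0. Qed.

Let mixed_binomial_sigma_additive nu p :
  semi_sigma_additive (mixed_binomial nu p).
Proof.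
move=> F mF tF mUF; apply: cvg_toP.
  apply: ereal_nondecreasing_is_cvgn => a b ab.
  exact: lee_sum_nneg_natr.
by rewrite /mixed_binomial nneseries_sum_bigcup.
Qed.

HB.instance Definition _ nu p := isMeasure.Build _ _ _ (mixed_binomial nu p)
  (mixed_binomial0 nu p) (mixed_binomial_ge0 nu p)
  (@mixed_binomial_sigma_additive nu p).

Let mixed_binomial_setT nu p : mixed_binomial nu p [set: nat] = 1.
Proof.
rewrite /mixed_binomial -nneseries_esumT//.
transitivity (\sum_(j <oo) \sum_(l <oo)
    (binomial_pmf l p%:num j)%:E * nu [set l]).
  apply: eq_eseriesr => j _.
  rewrite [RHS](@nneseries_split _ _ 0%N j)// add0n big_nat big1 ?add0e//.
  by move=> l /andP[_ lj]; rewrite /binomial_pmf bin_small// mulr0n mul0e.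
rewrite nneseries_interchange//.
transitivity (\sum_(l <oo) nu [set l]).
  apply: eq_eseriesr => l _.
  have p01 : (0 <= p%:num <= 1)%R by apply/andP; split.
  under eq_eseriesr do rewrite muleC.
  rewrite -(@fineK _ (nu [set l])) ?fin_num_measure// nneseriesZl; last first.
    by move=> j _; rewrite lee_fin binomial_pmf_ge0.
  rewrite nneseries_esumT; last by move=> j; rewrite lee_fin binomial_pmf_ge0.
  have := probability_setT (binomial_prob l p%:num).
  by rewrite /= /binomial_prob p01 => ->; rewrite mule1.
rewrite -(probability_setT nu) -[in RHS](image_id [set: nat]) -bigcup_imset1.
rewrite measure_bigcup//=; last by move=> i j _ _ [x []] /= -> ->.
by apply: eq_eseriesl => l; rewrite in_setT.
Qed.

HB.instance Definition _ nu p := Measure_isProbability.Build _ _ _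
  (mixed_binomial nu p) (mixed_binomial_setT nu p).

End mixed_binomial.

Definition nat_add (x : nat * nat) : nat := (x.1 + x.2)%N.

Lemma measurable_nat_add : measurable_fun [set: nat * nat] nat_add.
Proof.
move=> _ U _; rewrite setTI; apply: countable_measurable; last exact: countableP.
move=> [a b].
rewrite (_ : [set (a, b)] = [set a] `*` [set b]); first exact: measurableX.
by apply/seteqP; split=> [_ ->//|[x y] /= [-> ->]].
Qed.

HB.instance Definition _ :=
  isMeasurableFun.Build _ _ _ _ nat_add measurable_nat_add.

Section laws_on_nat.
Context {R : realType}.
Implicit Types P Q : probability nat R.

Definition conv P Q : probability nat R := distribution (P \x Q)%E nat_add.

Definition nconv n (P : 'I_n -> probability nat R) : probability nat R :=
  \big[conv/dirac 0%N : probability nat R]_(k < n) P k.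

(* nat carries the discrete topology, so the continuity requirement is void;
   the test functions are those of weak convergence on a topological space. *)
Definition weak_cvg (P_ : nat -> probability nat R) P :=
  forall f : nat -> R, continuous f -> bounded_fun f ->
    ('E_(P_ n)[f] @[n --> \oo] --> 'E_P[f])%E.

(* R[i] has no canonical topology; R[i]^o carries that of the modulus. *)
Definition pgf P (z : R[i]) : R[i]^o :=
  limn (series (fun j => (fine (P [set j]))%:C%C * z ^+ j : R[i]^o)).

Definition cexp (z : R[i]) : R[i] :=
  let: (a +i* b)%C := z in ((expR a * cos b) +i* (expR a * sin b))%C.

(* P is CP(mu). *)
Definition compound_poisson (mu : {finite_measure set nat -> \bar R}) P :=
  forall z : R[i], `|z| <= 1 ->
    pgf P z = cexp (limn (series (fun i =>
      (fine (mu [set i.+1]))%:C%C * (z ^+ i.+1 - 1) : R[i]^o))).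

Definition intensity_series (lambda : nat -> R) (j : nat) : nat -> R :=
  series (fun i => (-1) ^+ i / i`!%:R * lambda (j + i)%N).

Definition intensity (lambda : nat -> R) (j : nat) : R :=
  (j`!%:R)^-1 * limn (intensity_series lambda j).

(* Extended-real valued, as no integrability is required of X. *)
Definition factorial_moment d (T : measurableType d) (Pr : probability T R)
    (X : {RV Pr >-> nat}) (j : nat) : \bar R :=
  ('E_Pr[fun w => (X w ^_ j)%:R])%E.

End laws_on_nat.

(* Main.v *)
Require Import Defs.
From HB Require Import structures.
From mathcomp Require Import all_boot all_order all_algebra.
From mathcomp Require Import all_classical all_reals all_analysis.
From mathcomp Require Import complex.
From mathcomp Require Import ring lra.

Set Implicit Arguments.
Unset Strict Implicit.
Unset Printing Implicit Defensive.

Import Order.TTheory GRing.Theory Num.Theory.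
Import numFieldNormedType.Exports.
Local Open Scope classical_set_scope.
Local Open Scope ring_scope.

(** Let [X_{n,k}] have law [Bi(L(zeta_{n,k}), p_{n,k})].  Integrating the
    Bonferroni inequalities for [(1 - p)^m] against [L(zeta_{n,k})] encloses
    [sum_k P(X_{n,k} = j)] between consecutive partial sums of the series that
    defines [mu{j}], with the sums of (i) at stage [n] in place of the [lambda_j]; hence
    [sum_k P(X_{n,k} = j)] tends to [mu{j}] for [j >= 1].  The bounded means
    [sum_k E X_{n,k} = sum_k p_{n,k} E zeta_{n,k}] make these masses tight, so
    [mu] is finite and, for [|z| <= 1],
    [sum_k (E z^X_{n,k} - 1)] tends to [sum_j mu{j} (z^j - 1)].
    Since [|1 + w - e^w| = O(|w|^2)] when [|1 + w| <= 1], hypothesis (ii) allows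
    [prod_k E z^X_{n,k}] to be replaced by the exponential of that sum.  The
    limit law [CP(mu)] needs no separate construction: convergence of the
    generating functions on [(0, 1)] forces each mass of the convolutions to
    converge, and the bounded means prevent loss of mass at infinity. *)

(** * Bonferroni inequalities *)

(** Induction on [m]: by Pascal's rule the error for [(m.+1, r.+1)] is the error for [(m, r.+1)]
    minus [p] times the one for [(m, r)], and the alternating sign makes both contributions
    non-negative. *)
Lemma bonferroni_pow (R : realType) (p : R) (m r : nat) : 0 <= p <= 1 ->
  0 <= (-1) ^+ r * (\sum_(i < r.+1) 'C(m, i)%:R * (- p) ^+ i - (1 - p) ^+ m).
Proof.
move=> /andP[p0 p1]; elim: m r => [|m IH] r.
  rewrite expr0 big_ord_recl big1 ?addr0 ?bin0 ?expr0 ?mulr1 ?subrr ?mulr0//.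
  by move=> i _; rewrite bin_small// mul0r.
case: r => [|r].
  rewrite big_ord1 bin0 !expr0 !mul1r subr_ge0 exprn_ile1 ?subr_ge0//.
  by rewrite gerBl.
have -> : \sum_(i < r.+2) 'C(m.+1, i)%:R * (- p) ^+ i =
    \sum_(i < r.+2) 'C(m, i)%:R * (- p) ^+ i
    - p * \sum_(i < r.+1) 'C(m, i)%:R * (- p) ^+ i.
  rewrite big_ord_recl [in RHS]big_ord_recl !bin0 -addrA; congr (_ + _).
  rewrite mulr_sumr -sumrB; apply: eq_bigr => i _.
  by rewrite /= /bump /= add1n binS natrD exprS; ring.
have := addr_ge0 (IH r.+1) (mulr_ge0 p0 (IH r)).
by congr (_ <= _); rewrite !exprS; ring.
Qed.

(** Serves to split off the factor ['C(n, j)] common to all terms of the truncated series for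
    [binomial_pmf]; for [n < j] both sides vanish. *)
Lemma ffact_split (n j i : nat) :
  (n ^_ (j + i) = 'C(n, j) * 'C(n - j, i) * (j`! * i`!))%N.
Proof.
rewrite -[RHS]mulnA [X in (_ * X)%N]mulnCA mulnA !bin_ffact.
elim: j n => [|j IH] n; first by rewrite subn0 ffactn0 mul1n.
by case: n => [|n]; rewrite ?ffact0n// addSn !ffactSS IH subSS mulnA.
Qed.

(** Factoring out ['C(l, j)%:R * p ^+ j] leaves [bonferroni_pow] with [m = l - j]. Falling
    factorials are used because they integrate to factorial moments. *)
Lemma bonferroni_binomial (R : realType) (p : R) (l j r : nat) : 0 <= p <= 1 ->
  0 <= (-1) ^+ r * (\sum_(i < r.+1) (-1) ^+ i / (i`!%:R * j`!%:R) *
          (p ^+ (j + i) * (l ^_ (j + i))%:R) - binomial_pmf l p j).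
Proof.
move=> p01.
have fact_neq0 i : i`!%:R != 0 :> R by rewrite pnatr_eq0 -lt0n fact_gt0.
have -> : \sum_(i < r.+1) (-1) ^+ i / (i`!%:R * j`!%:R) *
          (p ^+ (j + i) * (l ^_ (j + i))%:R) - binomial_pmf l p j =
  'C(l, j)%:R * p ^+ j * (\sum_(i < r.+1) 'C(l - j, i)%:R * (- p) ^+ i -
     (1 - p) ^+ (l - j)).
  rewrite mulrBr mulr_sumr; congr (_ - _); last first.
    by rewrite /binomial_pmf -mulr_natr /unstable.onem; ring.
  apply: eq_bigr => i _; rewrite ffact_split !natrM exprD [(- p) ^+ i]exprNn.
  by field; rewrite !fact_neq0.
rewrite mulrCA; apply: mulr_ge0; last exact: bonferroni_pow.
by case/andP: p01 => p0 _; rewrite mulr_ge0 ?exprn_ge0.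
Qed.

(** * Tight sequences of masses *)

Section tight_series.
Context {R : realType}.
Implicit Types (h f : nat -> R) (C B : R).

(** Since [h j <= j * h j] for [j >= 1], the partial sums of [h] are at most [h 0 + C], which gives
    absolute convergence. *)
Lemma series_tight_cvg h f C B : (forall j, 0 <= h j) ->
  (forall J, \sum_(0 <= j < J) j%:R * h j <= C) -> (forall j, `|f j| <= B) ->
  cvgn (series (fun j => f j * h j)).
Proof.
move=> h0 hC fB; apply: normed_cvg.
have B0 : 0 <= B by apply: le_trans (fB 0%N).
apply: nondecreasing_is_cvgn.
  by apply: nondecreasing_series => n _ _; exact: normr_ge0.
exists (B * (h 0%N + C)) => _ [n _ <-] /=.
apply: (@le_trans _ _ (\sum_(0 <= j < n.+1) B * h j)).
  rewrite /series /= [leRHS]big_nat_recr//= ler_wpDr ?mulr_ge0//.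
  by apply: ler_sum => j _; rewrite normrM (ger0_norm (h0 j)) ler_wpM2r.
rewrite -mulr_sumr ler_wpM2l// big_nat_recl// lerD2l.
apply: le_trans (hC n.+1); rewrite [leRHS]big_nat_recl// mul0r add0r.
apply: ler_sum => j _; rewrite ler_peMl// ler1n//.
Qed.

(** Markov's inequality for the tail: [h j <= j * h j / J] whenever [j >= J]. *)
Lemma series_tight_dist h f C B J : (forall j, 0 <= h j) ->
  (forall J, \sum_(0 <= j < J) j%:R * h j <= C) -> (forall j, `|f j| <= B) ->
  (0 < J)%N ->
  `|limn (series (fun j => f j * h j)) - series (fun j => f j * h j) J|
    <= B * C / J%:R.
Proof.
move=> h0 hC fB J0; set u := fun j => f j * h j.
have B0 : 0 <= B by apply: le_trans (fB 0%N).
have cu : cvgn (series u) by exact: series_tight_cvg hC fB.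
have cd : `|series u n - series u J| @[n --> \oo] --> `|limn (series u) -
  series u J|.
  by apply: cvg_norm; apply: cvgB => //; exact: cvg_cst.
apply: (cvgr_to_le cd).
exists J => // K /= JK.
rewrite sub_series_geq// (le_trans (ler_norm_sum _ _ _))//.
apply: (@le_trans _ _ (\sum_(J <= j < K) B * (j%:R * h j) / J%:R)).
  rewrite big_nat [leRHS]big_nat; apply: ler_sum => j /andP[Jj _].
  rewrite normrM (ger0_norm (h0 j)).
  apply: (@le_trans _ _ (B * h j)); first by rewrite ler_wpM2r.
  rewrite -mulrA ler_wpM2l// mulrAC ler_peMl// ler_pdivlMr ?ltr0n//.
  by rewrite mul1r ler_nat.
rewrite -mulr_suml -mulr_sumr ler_wpM2r ?invr_ge0// ler_wpM2l//.
apply: le_trans (hC K); rewrite (@big_cat_nat _ _ _ J 0 K)//= lerDr.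
by apply: sumr_ge0 => j _; rewrite mulr_ge0.
Qed.

(* The uniform bound on the first moments is what provides tightness. *)
Lemma tight_cvg (h_ : nat -> nat -> R) h f C B :
  (forall n j, 0 <= h_ n j) ->
  (forall j, h_ n j @[n --> \oo] --> h j) ->
  (\forall n \near \oo, forall J, \sum_(0 <= j < J) j%:R * h_ n j <= C) ->
  (forall j, `|f j| <= B) ->
  [/\ forall j, 0 <= h j, forall J, \sum_(0 <= j < J) j%:R * h j <= C &
   limn (series (fun j => f j * h_ n j)) @[n --> \oo] -->
   limn (series (fun j => f j * h j))].
Proof.
move=> h_0 hh hC fB.
have cvgsum (g : nat -> R) J : \sum_(0 <= j < J) g j * h_ n j @[n --> \oo] -->
    \sum_(0 <= j < J) g j * h j.
  apply: cvg_big => [|j _]; last by apply: cvgMl_tmp; exact: hh.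
  exact: add_continuous.
have h0 j : 0 <= h j.
  by apply: (cvgr_to_ge (hh j)); near=> n; exact: h_0.
have hsC J : \sum_(0 <= j < J) j%:R * h j <= C.
  apply: (cvgr_to_le (cvgsum (fun j => j%:R) J)).
  by apply: filterS hC => n; apply.
split=> //; apply/cvgrPdist_le => e e0.
(* Each of the two tails beyond [J.+1] gets [e / 4], which leaves [e / 2] for the finite sums. *)
have [J /= HJ] : exists J, 4 * (B * C / J.+1%:R) <= e.
  exists (Num.truncn (4 * (B * C) / e)); rewrite mulrA ler_pdivrMr ?ltr0n//.
  by rewrite -ler_pdivrMl// mulrC ltW// truncnS_gt.
have /cvgrPdist_le/(_ (e / 2) (divr_gt0 e0 (ltr0Sn _ 1))) H := cvgsum f J.+1.
near=> n.
have Hn : forall J, \sum_(0 <= j < J) j%:R * h_ n j <= C by near: n.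
have H1 := series_tight_dist h0 hsC fB (ltn0Sn J).
have H2 := series_tight_dist (h_0 n) Hn fB (ltn0Sn J).
have H3 : `|series (fun j => f j * h j) J.+1 - series (fun j => f j * h_ n j)
  J.+1|
   <= e / 2 by near: n.
move: HJ H1 H2 H3; set t := B * C / _; set a := limn _; set b := limn _.
set c := series _ _; set d := series _ _ => HJ H1 H2 H3.
have -> : a - b = (a - c) + (c - d) + (d - b) by ring.
have := ler_normD (a - c + (c - d)) (d - b); rewrite (distrC d b).
have := ler_normD (a - c) (c - d); lra.
Unshelve. all: by end_near. Qed.

(** Comparison with the geometric series; peeling off the constant term is what recovers the
    coefficients one at a time. *)
Lemma gf_recl (u : nat -> R) x : 0 < x < 1 -> (forall j, 0 <= u j <= 1) ->
  [/\ cvgn (series (fun j => u j * x ^+ j)),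
    0 <= limn (series (fun j => u j * x ^+ j)) <= (1 - x)^-1 &
    limn (series (fun j => u j * x ^+ j)) =
    u 0%N + x * limn (series (fun j => u j.+1 * x ^+ j))].
Proof.
move=> /andP[x0 x1] u01.
have xn : `|x| < 1 by rewrite ger0_norm// ltW.
have gE : geometric 1 x = (fun j => x ^+ j).
  by apply/funext => i /=; rewrite mul1r.
have cg := @is_cvg_geometric_series _ 1 x xn.
have ge (v : nat -> R) j : 0 <= v j <= 1 -> 0 <= v j * x ^+ j.
  by case/andP => v0 _; rewrite mulr_ge0 ?exprn_ge0 ?(ltW x0).
have le (v : nat -> R) j : 0 <= v j <= 1 -> v j * x ^+ j <= geometric 1 x j.
  by rewrite gE => /andP[v0 v1]; rewrite ler_piMl ?exprn_ge0 ?(ltW x0).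
have cu (v : nat -> R) : (forall j, 0 <= v j <= 1) ->
    cvgn (series (fun j => v j * x ^+ j)).
  move=> v01; apply: series_le_cvg cg => // i; [exact: ge| |exact: le].
  by rewrite gE exprn_ge0// ltW.
split; first exact: cu.
  apply/andP; split.
    apply: limr_ge; first exact: cu.
    by near=> n; apply: sumr_ge0 => j _; exact: ge.
  rewrite -[leRHS]mul1r -(cvg_lim _ (@cvg_geometric_series _ 1 x xn))//.
  by apply: lim_series_le => //; [exact: cu|move=> i; exact: le].
apply: cvg_lim => //; rewrite -(cvg_shiftS (series _)).
under eq_fun do rewrite /series /= big_nat_recl// expr0 mulr1.
apply: cvgD; first exact: cvg_cst.
rewrite (_ : (fun _ => _) =
    fun n => x * series (fun j => u j.+1 * x ^+ j) n).
  by apply: cvgMl_tmp; exact: cu.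
apply/funext => n; rewrite mulr_sumr; apply: eq_bigr => k _.
by rewrite exprS mulrCA.
Unshelve. all: by end_near. Qed.

(* The terms of positive degree contribute at most [x / (1 - x)], so a small [x]
   makes the constant terms Cauchy. *)
Lemma cvg_coef0 (q : nat -> nat -> R) : (forall n j, 0 <= q n j <= 1) ->
  (forall x, 0 < x < 1 ->
     cvgn (fun n => limn (series (fun j => q n j * x ^+ j)))) ->
  cvgn (fun n => q n 0%N).
Proof.
move=> q01 qx; apply: cauchy_cvg; apply: cauchy_exP => e e0.
(* [x <= 1 / 2] bounds the shifted series by 2, and [x <= e / 8] then bounds the non-constant terms
   by [e / 4]. *)
pose x := Num.min (1 / 2) (e / 8).
have x0 : 0 < x by rewrite lt_min; apply/andP; split; lra.
have [x2 xe] : x <= 1 / 2 /\ x <= e / 8 by rewrite !ge_min !lexx ?orbT.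
have x01 : 0 < x < 1 by rewrite x0; lra.
have /cvgrPdist_le/(_ (e / 2) (divr_gt0 e0 (ltr0Sn _ 1))) := qx x x01.
set L := limn _ => H; exists L.
change (\forall n \near \oo, `|L - q n 0%N| < e); apply: filterS H => n.
have [_ _ ->] := gf_recl x01 (q01 n).
have [_ + _] := gf_recl x01 (fun j => q01 n j.+1).
set S := limn _ => /andP[S0 S1] H1.
have S2 : S <= 2.
  by apply: le_trans S1 _; rewrite -[leRHS]invrK lef_pV2 ?posrE//; lra.
have xS : x * S <= e / 4.
  by apply: (@le_trans _ _ (x * 2)); [rewrite ler_wpM2l// ltW|lra].
rewrite (_ : L - q n 0%N = (L - (q n 0%N + x * S)) + x * S); last by ring.
rewrite (le_lt_trans (ler_normD _ _))// (ger0_norm (mulr_ge0 (ltW x0) S0)); lra.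
Qed.

(** Induction on [j]: subtracting the constant term, which converges by [cvg_coef0], and dividing by
    [x] gives the generating function of the shifted sequence, so that one converges too. *)
Lemma cvg_coef (q : nat -> nat -> R) : (forall n j, 0 <= q n j <= 1) ->
  (forall x, 0 < x < 1 ->
     cvgn (fun n => limn (series (fun j => q n j * x ^+ j)))) ->
  forall j, cvgn (fun n => q n j).
Proof.
move=> + + j; elim: j q => [|j IH] q q01 qx; first exact: cvg_coef0.
apply: (IH (fun n j => q n j.+1)) => // x x01.
have /andP[x0 _] := x01.
rewrite (_ : (fun _ => _) = fun n =>
  x^-1 * (limn (series (fun j => q n j * x ^+ j)) - q n 0%N)).
  apply: is_cvgMl_tmp; apply: is_cvgB; first exact: qx.
  exact: cvg_coef0.
apply/funext => n; have [_ _ ->] := gf_recl x01 (q01 n).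
by rewrite addrAC subrr add0r mulKf// gt_eqF.
Qed.

End tight_series.

(** * The complex exponential *)

Section complex_exponential.
Context {R : realType}.
Local Notation Re := complex.Re.
Local Notation Im := complex.Im.
Implicit Types (x y : R) (z w : R[i]).

Lemma norm_le_complex z x : (`|z| <= x%:C%C) =
  (0 <= x) && (Re z ^+ 2 + Im z ^+ 2 <= x ^+ 2).
Proof.
rewrite normc_def lecR; set s := _ + _.
have [x0|x0] /= := leP 0 x; last first.
  by apply/negbTE; rewrite -ltNge (lt_le_trans x0)// sqrtr_ge0.
by rewrite -{1}(ger0_norm x0) -sqrtr_sqr ler_sqrt// sqr_ge0.
Qed.

Lemma normc_le_ReIm z : `|z| <= (`|Re z| + `|Im z|)%:C%C.
Proof.
rewrite norm_le_complex addr_ge0//= sqrrD !real_normK ?num_real//.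
by rewrite lerD2r lerDl mulrn_wge0// mulr_ge0.
Qed.

Lemma ReIm_le_normc z x : `|z| <= x%:C%C -> `|Re z| <= x /\ `|Im z| <= x.
Proof.
rewrite norm_le_complex => /andP[x0 H].
by split; rewrite -(ler_pXn2r (n := 2))// ?nnegrE// real_normK ?num_real//;
  apply: le_trans H; rewrite ?lerDl ?lerDr sqr_ge0.
Qed.

Lemma norm_sin_le x : `|sin x| <= `|x|.
Proof.
wlog x0 : x / 0 < x.
  move=> H; have [x0|x0|->] := ltgtP x 0; [|exact: H|by rewrite sin0].
  by rewrite -normrN -sinN -[leRHS]normrN; apply: H; rewrite oppr_gt0.
have [c _] := @MVT R sin cos 0 x x0 (fun y _ => is_derive_sin y)
  (continuous_subspaceT (@continuous_sin R)).
by rewrite sin0 !subr0 => ->; rewrite normrM ler_piMl// cos_max.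
Qed.

Lemma onem_cos_le x : 0 <= 1 - cos x <= x ^+ 2 / 2.
Proof.
rewrite subr_ge0 cos_le1/=.
have -> : cos x = 1 - (sin (x / 2) ^+ 2) *+ 2.
  rewrite [in LHS](_ : x = (x / 2) *+ 2); last by rewrite -mulr_natr divfK.
  rewrite cos_mulr2n sin2cos2; ring.
have : sin (x / 2) ^+ 2 <= (x / 2) ^+ 2.
  by rewrite -[leLHS]real_normK ?num_real// -[leRHS]real_normK ?num_real//
     ler_pXn2r ?nnegrE// norm_sin_le.
rewrite expr_div_n; lra.
Qed.

(** Mean value theorem for [sin y - y]: for [x > 0] the increment is at most [x ^ 3 / 2] in absolute
    value, and [x <= 1] turns the cube into a square. *)
Lemma sinB_le x : `|x| <= 1 -> `|sin x - x| <= x ^+ 2 / 2.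
Proof.
wlog x0 : x / 0 < x.
  move=> H; have [x0|x0|->] := ltgtP x 0;
    [|exact: H|by rewrite sin0 subrr normr0 expr0n mul0r].
  move=> x1; rewrite -normrN opprD -sinN -sqrrN; apply: H; rewrite ?oppr_gt0//.
  by rewrite normrN.
move=> x1.
have csin : {within `[0, x], continuous (fun y => sin y - y : R)}.
  apply: continuous_subspaceT => y.
  by apply: cvgB; [exact: continuous_sin|exact: cvg_id].
have [c] := @MVT R (fun y => sin y - y) (fun y => cos y - 1) 0 x x0
  (fun y _ => is_deriveB (is_derive_sin y) (is_derive_id y 1)) csin.
rewrite in_itv /= => /andP[c0 cx].
rewrite sin0 !subr0 => ->; rewrite normrM distrC.
have /andP[H0 H1] := onem_cos_le c.
rewrite (gtr0_norm x0) in x1 *; rewrite (ger0_norm H0).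
have : c ^+ 2 <= x ^+ 2 by rewrite ler_pXn2r ?nnegrE ?ltW.
move=> H2; apply: (@le_trans _ _ (x ^+ 2 / 2 * x)).
  by rewrite ler_wpM2r ?(ltW x0)//; lra.
by rewrite ler_piMr// divr_ge0// sqr_ge0.
Qed.

(** The upper bound combines [expR x * (1 - x) <= expR x * expR (- x) = 1] with [(1 + x + x ^ 2) *
    (1 - x) = 1 - x ^ 3 >= 1]. *)
Lemma expR_taylor x : x <= 0 -> 0 <= expR x - (1 + x) <= x ^+ 2.
Proof.
move=> x0; rewrite subr_ge0 expR_ge1Dx/= lerBlDr.
have x1 : 0 < 1 - x by lra.
have : expR x * (1 - x) <= 1.
  rewrite -[leRHS](expRxMexpNx_1 x) ler_wpM2l ?expR_ge0//.
  exact: (expR_ge1Dx (- x)).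
rewrite -ler_pdivlMr// => /le_trans; apply; rewrite ler_pdivrMr//.
have : 0 <= x ^+ 2 * (- x) by rewrite mulr_ge0 ?sqr_ge0// oppr_ge0.
nra.
Qed.

Lemma normc_le1_Re w : `|1 + w| <= 1 -> Re w <= 0.
Proof.
rewrite -[leRHS]/(1%:C%C) norm_le_complex; case: w => a b /= /andP[_].
have := sqr_ge0 a; have := sqr_ge0 b; rewrite add0r !expr2; nra.
Qed.

(** The hypothesis forces [Re w <= 0] and [|Im w| <= 1], where [expR_taylor], [onem_cos_le] and
    [sinB_le] apply. The constant is generous: the two components together cost [3 / 2]. *)
Lemma cexp_taylor w : `|1 + w| <= 1 ->
  `|1 + w - cexp w| <= (3 * (Re w ^+ 2 + Im w ^+ 2))%:C%C.
Proof.
move=> w1; have := normc_le1_Re w1; move: w1;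
  rewrite -[X in _ <= X]/(1%:C%C) norm_le_complex.
case: w => a b /= /andP[_ ab1] a0.
have b1 : `|b| <= 1.
  rewrite -(ler_pXn2r (n := 2))// ?nnegrE// real_normK ?num_real// expr1n.
  by have := sqr_ge0 (1 + a); rewrite add0r in ab1; lra.
apply: le_trans (normc_le_ReIm _) _; rewrite lecR /= add0r.
have /andP[e0 e1] := expR_taylor a0.
have /andP[c0 c1] := onem_cos_le b.
have s1 := sinB_le b1.
have ea1 : expR a <= 1 by rewrite expR_le1.
have H1 : `|1 + a - expR a * cos b| <= a ^+ 2 + b ^+ 2 / 2.
  rewrite (_ : _ - _ = expR a * (1 - cos b) - (expR a - (1 + a))); last by ring.
  rewrite (le_trans (ler_normB _ _))// (ger0_norm e0) ger0_norm ?mulr_ge0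
    ?expR_ge0//.
  rewrite addrC lerD// (le_trans _ c1)// ler_piMl//.
have H2 : `|b - expR a * sin b| <= `|a| * `|b| + b ^+ 2 / 2.
  rewrite (_ : _ - _ = (1 - expR a) * sin b - (sin b - b)); last by ring.
  rewrite (le_trans (ler_normB _ _))// lerD// normrM ler_pM ?norm_sin_le//.
  by rewrite ger0_norm ?subr_ge0// ler0_norm//; lra.
have : `|a| * `|b| <= (a ^+ 2 + b ^+ 2) / 2.
  have := sqr_ge0 (`|a| - `|b|).
  by rewrite sqrrB !real_normK ?num_real// -mulr_natr; lra.
have := sqr_ge0 a; have := sqr_ge0 b; lra.
Qed.

Lemma cexpD w z : cexp (w + z) = cexp w * cexp z.
Proof.
case: w z => [a b] [c d]; rewrite /cexp /=.
by rewrite expRD sinD cosD; congr Complex; ring.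
Qed.

Lemma cexp0 : cexp (0 : R[i]) = 1.
Proof. by rewrite /cexp /= expR0 cos0 sin0 mulr1 mulr0. Qed.

Lemma cexp_sum (I : Type) (s : seq I) (w : I -> R[i]) :
  cexp (\sum_(i <- s) w i) = \prod_(i <- s) cexp (w i).
Proof. exact: (big_morph _ cexpD cexp0). Qed.

Lemma normc_cexp_le1 w : Re w <= 0 -> `|cexp w| <= 1.
Proof.
case: w => a b /= a0; rewrite -[leRHS]/(1%:C%C) norm_le_complex ler01/=.
by rewrite !exprMn -mulrDr cos2Dsin2 mulr1 expr1n exprn_ile1 ?expR_ge0
  ?expR_le1.
Qed.

(** Telescoping: factors are exchanged one at a time, the others having modulus at most 1. *)
Lemma norm_prodB_le (C : numDomainType) (I : Type) (s : seq I) (a b : I -> C) :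
  (forall i, `|a i| <= 1) -> (forall i, `|b i| <= 1) ->
  `|\prod_(i <- s) a i - \prod_(i <- s) b i| <= \sum_(i <- s) `|a i - b i|.
Proof.
move=> a1 b1; have prod1 : `|\prod_(i <- s) b i| <= 1.
  by rewrite normr_prod; apply: prodr_ile1 => i _; rewrite normr_ge0 b1.
elim: s prod1 => [|i s IH] _; first by rewrite !big_nil subrr normr0.
rewrite !big_cons.
have -> : a i * \prod_(j <- s) a j - b i * \prod_(j <- s) b j =
  (a i - b i) * \prod_(j <- s) b j + a i * (\prod_(j <- s) a j - \prod_(j <- s)
    b j).
  ring.
have prod1 : `|\prod_(i <- s) b i| <= 1.
  by rewrite normr_prod; apply: prodr_ile1 => k _; rewrite normr_ge0 b1.
rewrite (le_trans (ler_normD _ _))// lerD// normrM ?ler_piMr//.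
by apply: le_trans (IH prod1); rewrite ler_piMl.
Qed.

Lemma Re_sum (I : Type) (s : seq I) (w : I -> R[i]) :
  Re (\sum_(i <- s) w i) = \sum_(i <- s) Re (w i).
Proof. by apply: (big_morph (@Re R)) => // -[? ?] []. Qed.

Lemma Im_sum (I : Type) (s : seq I) (w : I -> R[i]) :
  Im (\sum_(i <- s) w i) = \sum_(i <- s) Im (w i).
Proof. by apply: (big_morph (@Im R)) => // -[? ?] []. Qed.

Let ReB z w : Re (z - w) = Re z - Re w.
Proof. by case: z w => [? ?] [? ?]. Qed.

Let ImB z w : Im (z - w) = Im z - Im w.
Proof. by case: z w => [? ?] [? ?]. Qed.

(** All [1 + w n k] and [cexp (w n k)] lie in the closed unit disc, so the two products differ by at
    most 3 times the sum of squared moduli. Working by components keeps the limits in [R]. *)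
Lemma cvg_prod_cexp (k_ : nat -> nat) (w : forall n, 'I_(k_ n) -> R[i])
    (W : R[i]) :
  (forall n k, `|1 + w n k| <= 1) ->
  \sum_(k < k_ n) (Re (w n k) ^+ 2 + Im (w n k) ^+ 2) @[n --> \oo] --> 0 ->
  \sum_(k < k_ n) Re (w n k) @[n --> \oo] --> Re W ->
  \sum_(k < k_ n) Im (w n k) @[n --> \oo] --> Im W ->
  Re (\prod_(k < k_ n) (1 + w n k)) @[n --> \oo] --> Re (cexp W) /\
  Im (\prod_(k < k_ n) (1 + w n k)) @[n --> \oo] --> Im (cexp W).
Proof.
move=> w1 sq cRe cIm.
pose S n := \sum_(k < k_ n) (Re (w n k) ^+ 2 + Im (w n k) ^+ 2).
pose E n := cexp (\sum_(k < k_ n) w n k).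
pose Pi n := \prod_(k < k_ n) (1 + w n k).
have bnd n : `|Re (Pi n - E n)| <= 3 * S n /\ `|Im (Pi n - E n)| <= 3 * S n.
  apply: ReIm_le_normc; rewrite /Pi /E cexp_sum.
  apply: le_trans (norm_prodB_le _ (w1 n) _) _.
    by move=> k; exact/normc_cexp_le1/normc_le1_Re.
  rewrite /S mulr_sumr rmorph_sum; apply: ler_sum => k _.
  exact: cexp_taylor.
have S0 : 3 * S n @[n --> \oo] --> 0 by rewrite -[X in _ --> X](mulr0 3);
  exact: cvgMl_tmp.
have cE : Re (E n) @[n --> \oo] --> Re (cexp W) /\
    Im (E n) @[n --> \oo] --> Im (cexp W).
  have EE n : E n = cexp ((\sum_(k < k_ n) Re (w n k)) +i* \sum_(k < k_ n) Im
    (w n k))%C.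
    by rewrite -Re_sum -Im_sum /E; case: (\sum_(k < k_ n) w n k).
  case: (W) cRe cIm => a b /= cRe cIm.
  have ce := cvg_comp _ _ cRe (@continuous_expR R a).
  have cc := cvg_comp _ _ cIm (@continuous_cos R b).
  have cs := cvg_comp _ _ cIm (@continuous_sin R b).
  by split; under eq_cvg do rewrite EE /=; exact: cvgM.
have aux (f g : nat -> R) (l : R) : (forall n, `|f n - g n| <= 3 * S n) ->
    g n @[n --> \oo] --> l -> f n @[n --> \oo] --> l.
  move=> fg gl; rewrite (_ : f = (f - g) + g); last by apply/funext => n /=;
    rewrite subrK.
  have -> : l = 0 + l by rewrite add0r.
  apply: cvgD => //; apply/cvgr0Pnorm_le => e e0.
  move/cvgr0Pnorm_le : S0 => /(_ e e0); apply: filterS => n; apply: le_trans.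
  by apply: le_trans (fg n) _; exact: ler_norm.
have [ReE ImE] := cE.
by split; [apply: aux ReE|apply: aux ImE] => n; rewrite -?ReB -?ImB;
  have [] := bnd n.
Qed.

Lemma cvg_complex (u : nat -> R[i]^o) x y : Re (u n) @[n --> \oo] --> x ->
  Im (u n) @[n --> \oo] --> y -> u n @[n --> \oo] --> ((x +i* y)%C : R[i]^o).
Proof.
move=> /cvgrPdist_le cx /cvgrPdist_le cy; apply/cvgrPdist_le => -[e e'];
  rewrite ltcE /=.
(* In the order of [R[i]], [0 < e] forces a zero imaginary part, so the tolerance is real. *)
case/andP => /eqP -> e0.
have e20 : 0 < e / 2 by rewrite divr_gt0.
near=> n; apply: le_trans (normc_le_ReIm _) _;
  rewrite lecR [leRHS]splitr lerD//.
  by have : `|x - Re (u n)| <= e / 2 by [near: n; exact: cx]; case: (u n).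
by have : `|y - Im (u n)| <= e / 2 by [near: n; exact: cy]; case: (u n).
Unshelve. all: by end_near. Qed.

End complex_exponential.

(** * Laws on the natural numbers *)

Lemma measurable_nat2 (A : set (nat * nat)) : measurable A.
Proof.
apply: countable_measurable; last exact: countableP.
move=> [a b]; rewrite (_ : [set (a, b)] = [set a] `*` [set b]).
  exact: measurableX.
by apply/seteqP; split=> [_ ->//|[x y] /= [-> ->]].
Qed.

Section laws_on_nat.
Context {R : realType}.
Implicit Types (P Q nu : probability nat R) (f : nat -> R).

Let setT_nat P : P [set: nat] = 1%E.
Proof. exact: probability_setT. Qed.

(** Extended-real valued, as the means of an array are finite only from some [n] on. *)
Definition mean P : \bar R := (\int[P]_x (x%:R)%:E)%E.

Lemma mean_ge0 P : (0 <= mean P)%E.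
Proof. by apply: integral_ge0 => x _; rewrite lee_fin. Qed.

Lemma fine_set1_ge0 P j : 0 <= fine (P [set j]).
Proof. exact/fine_ge0/measure_ge0. Qed.

Lemma fine_set1K P j : (fine (P [set j]))%:E = P [set j].
Proof. by rewrite fineK// fin_num_measure. Qed.

Lemma integrable_bounded P f B : (forall j, `|f j| <= B) ->
  P.-integrable [set: nat] (EFin \o f).
Proof.
move=> fB; apply: measurable_bounded_integrable => //.
  by rewrite [X in (X < _)%E]setT_nat ltry.
by exists B; split; [rewrite num_real|move=> M BM x _;
  exact: le_trans (fB x) (ltW BM)].
Qed.

Lemma ge0_integral_nat P (f : nat -> \bar R) : (forall j, 0 <= f j)%E ->
  (\int[P]_x f x = \sum_(j <oo) f j * P [set j])%E.
Proof.
move=> f0; have <- : \bigcup_j [set j] = [set: nat].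
  by rewrite bigcup_imset1 image_id.
rewrite ge0_integral_bigcup//=; last by move=> i j _ _ [x [/= -> ->]].
apply: eq_eseriesr => j _; rewrite -(integral_cst P _ (f j))//.
by apply: eq_integral => x; rewrite inE /= => ->.
Qed.

Lemma sum_fine_set1_le1 P J : \sum_(0 <= j < J) fine (P [set j]) <= 1.
Proof.
rewrite -lee_fin -sumEFin; under eq_bigr do rewrite fine_set1K.
apply: le_trans (nneseries_lim_ge (m := 0) J _) _ => //.
under eq_eseriesr do rewrite -[P _]mul1e.
rewrite -(@ge0_integral_nat P (cst 1%E))// integral_cst//.
by rewrite mul1e [leLHS]setT_nat.
Qed.

(** Total mass at most 1 gives absolute convergence of the signed series; cutting [nat] into
    singletons identifies its sum. *)
Lemma cvg_series_Rintegral P f B : (forall j, `|f j| <= B) ->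
  series (fun j => f j * fine (P [set j])) @ \oo --> \int[P]_x f x.
Proof.
move=> fB; set u := fun j => _.
have B0 : 0 <= B by apply: le_trans (fB 0%N).
have cu : cvgn (series u).
  apply: normed_cvg; apply: nondecreasing_is_cvgn.
    by apply: nondecreasing_series => n _ _; exact: normr_ge0.
  exists (B * 1) => _ [n _ <-] /=.
  apply: le_trans (ler_wpM2l B0 (sum_fine_set1_le1 P n)).
  rewrite mulr_sumr; apply: ler_sum => j _.
  by rewrite normrM (ger0_norm (fine_set1_ge0 P j)) ler_wpM2r ?fine_set1_ge0.
suff -> : \int[P]_x f x = limn (series u) by [].
rewrite /Rintegral (_ : (\int[P]_x (f x)%:E)%E = (limn (series u))%:E)//.
rewrite -EFin_lim//; have <- : \bigcup_j [set j] = [set: nat].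
  by rewrite bigcup_imset1 image_id.
rewrite integral_bigcup//=.
- apply: congr_lim; apply/funext => n /=; rewrite /series/= -sumEFin.
  apply: eq_bigr => j _; rewrite EFinM fine_set1K -(integral_cst P _ (f
    j)%:E)//.
  by apply: eq_integral => x; rewrite inE /= => ->.
- by move=> i j _ _ [x [/= -> ->]].
- by rewrite bigcup_imset1 image_id; exact: integrable_bounded fB.
Qed.

Lemma sum_mean_le P J : (mean P < +oo)%E ->
  \sum_(0 <= j < J) j%:R * fine (P [set j]) <= fine (mean P).
Proof.
move=> Poo; rewrite -lee_fin -sumEFin fineK ?ge0_fin_numE ?mean_ge0//.
under eq_bigr do rewrite EFinM fine_set1K.
rewrite /mean ge0_integral_nat; last by move=> j; rewrite lee_fin.
by apply: nneseries_lim_ge => j _ _; rewrite mule_ge0// lee_fin.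
Qed.

(* [conv] alone is the convex combination of MathComp-Analysis. *)
Lemma mean_conv P Q : mean (Defs.conv P Q) = (mean P + mean Q)%E.
Proof.
rewrite /mean /Defs.conv ge0_integral_distribution//=.
rewrite fubini_tonelli1//=; last by move=> _ U _; exact: measurable_nat2.
rewrite /fubini_F /nat_add /=.
under eq_integral => x _.
  under eq_integral do rewrite natrD EFinD.
  rewrite ge0_integralD//; [|by move=> *; rewrite lee_fin..].
  rewrite integral_cst// [X in (_ * X)%E]setT_nat mule1; over.
rewrite ge0_integralD//; [|by move=> *; rewrite ?lee_fin//; exact: mean_ge0..].
by rewrite integral_cst// [X in (_ * X)%E]setT_nat mule1.
Qed.

Lemma mean_dirac0 : mean (dirac 0%N : probability nat R) = 0%E.
Proof. by rewrite /mean integral_dirac// diracT mul1e. Qed.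

Lemma mean_nconv n (P : 'I_n -> probability nat R) :
  mean (nconv P) = (\sum_(k < n) mean (P k))%E.
Proof. exact: (big_morph _ mean_conv mean_dirac0). Qed.

Lemma Rintegral_conv P Q f B : (forall j, `|f j| <= B) ->
  \int[Defs.conv P Q]_x f x = \int[P]_x \int[Q]_y f (x + y)%N.
Proof.
move=> fB; rewrite /Rintegral; congr fine.
have int2 : (P \x Q)%E.-integrable [set: nat * nat] ((EFin \o f) \o nat_add).
  apply: (@measurable_bounded_integrable _ _ _ _ (f \o nat_add)) => //.
  - by rewrite [X in (X < _)%E]probability_setT ltry.
  - by move=> _ U _; exact: measurable_nat2.
  - exists B; split; [by rewrite num_real|move=> M BM x _].
    exact: le_trans (fB _) (ltW BM).
rewrite /Defs.conv integral_distribution// -fubini1//.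
apply: eq_integral => x _; rewrite /fubini_F/= fineK//.
by apply: integrable_fin_num => //; apply: integrable_bounded => j; exact: fB.
Qed.

Lemma ReIm_expr_le1 (z : R[i]) j : `|z| <= 1 ->
  `|complex.Re (z ^+ j)| <= 1 /\ `|complex.Im (z ^+ j)| <= 1.
Proof. by move=> z1; apply: ReIm_le_normc; rewrite normrX exprn_ile1. Qed.

(** Two real integrals, so that Fubini and linearity apply; [pgfE] identifies it with [pgf] on the
    closed unit disc. *)
Definition gf P (z : R[i]) : R[i] :=
  ((\int[P]_x complex.Re (z ^+ x)) +i* (\int[P]_x complex.Im (z ^+ x)))%C.

Lemma gf_dirac0 z : gf (dirac 0%N : probability nat R) z = 1.
Proof.
by rewrite /gf /Rintegral !integral_dirac// diracT !mul1e expr0.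
Qed.

(** [z ^+ (x + y) = z ^+ x * z ^+ y] and Fubini, for the real and imaginary parts separately. *)
Lemma gf_conv P Q z : `|z| <= 1 -> gf (Defs.conv P Q) z = gf P z * gf Q z.
Proof.
move=> z1; have Rez j := (ReIm_expr_le1 j z1).1;
  have Imz j := (ReIm_expr_le1 j z1).2.
have iRe P' := integrable_bounded P' Rez;
  have iIm P' := integrable_bounded P' Imz.
have iZ c (f : nat -> R) P' : P'.-integrable setT (EFin \o f) ->
    P'.-integrable setT (EFin \o (fun x => c * f x)).
  by move=> fi; apply: (integrableZl _ c fi).
have iZr c (f : nat -> R) P' : P'.-integrable setT (EFin \o f) ->
    P'.-integrable setT (EFin \o (fun x => f x * c)).
  by move=> fi; apply: (integrableZr _ c fi).
have ReM (w v : R[i]) : complex.Re (w * v) =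
    complex.Re w * complex.Re v - complex.Im w * complex.Im v.
  by case: w v => [? ?] [? ?].
have ImM (w v : R[i]) : complex.Im (w * v) =
    complex.Re w * complex.Im v + complex.Im w * complex.Re v.
  by case: w v => [? ?] [? ?] /=.
rewrite /gf !(Rintegral_conv _ _ Rez, Rintegral_conv _ _ Imz).
have [iReP iReQ iImP iImQ] := And4 (iRe P) (iRe Q) (iIm P) (iIm Q).
set a := \int[Q]_x complex.Re (z ^+ x); set b := \int[Q]_x complex.Im (z ^+ x).
apply/eqP; rewrite eq_complex /=; apply/andP; split; apply/eqP.
  rewrite -(RintegralZr (mu := P) a)// -(RintegralZr (mu := P) b)//.
  rewrite -RintegralB//; [|exact: iZr..].
  apply: eq_Rintegral => x _; rewrite -!RintegralZl// -RintegralB//;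
    [|exact: iZ..].
  by apply: eq_Rintegral => y _; rewrite exprD ReM.
rewrite -(RintegralZr (mu := P) a)// -(RintegralZr (mu := P) b)//.
rewrite -RintegralD//; [|exact: iZr..].
apply: eq_Rintegral => x _; rewrite -!RintegralZl// -RintegralD//;
  [|exact: iZ..].
by apply: eq_Rintegral => y _; rewrite exprD ImM.
Qed.

Lemma gf_nconv n (P : 'I_n -> probability nat R) z : `|z| <= 1 ->
  gf (nconv P) z = \prod_(k < n) gf (P k) z.
Proof.
move=> z1; apply: (big_morph (gf^~ z)); last exact: gf_dirac0.
by move=> P1 P2; exact: gf_conv.
Qed.

Lemma normc_gf_le1 P z : `|z| <= 1 -> `|gf P z| <= 1.
Proof.
move=> z1; have Rez j := (ReIm_expr_le1 j z1).1;
  have Imz j := (ReIm_expr_le1 j z1).2.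
have iRe := integrable_bounded P Rez; have iIm := integrable_bounded P Imz.
rewrite -[leRHS]/(1%:C%C) norm_le_complex ler01 /= expr1n.
set a := \int[P]_x complex.Re (z ^+ x); set b := \int[P]_x complex.Im (z ^+ x).
have i1 : P.-integrable setT (EFin \o (fun x => a * complex.Re (z ^+ x))).
  exact: (integrableZl _ a iRe).
have i2 : P.-integrable setT (EFin \o (fun x => b * complex.Im (z ^+ x))).
  exact: (integrableZl _ b iIm).
(* [a u + b v <= (a^2 + b^2 + u^2 + v^2) / 2], integrated over [z^x = u + iv] *)
have : \int[P]_x (a * complex.Re (z ^+ x) + b * complex.Im (z ^+ x)) <=
    \int[P]_x ((a ^+ 2 + b ^+ 2 + 1) / 2).
  apply: le_Rintegral => //.
  - exact: (integrableD _ i1 i2).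
  - by apply: integrable_bounded => j; exact: lexx.
  - move=> x _; have : `|z ^+ x| <= 1%:C%C by rewrite normrX exprn_ile1.
    rewrite norm_le_complex expr1n => /andP[_].
    set u := complex.Re _; set v := complex.Im _ => uv.
    have := sqr_ge0 (a - u); have := sqr_ge0 (b - v); rewrite !sqrrB; lra.
(* The left-hand integral is [a ^+ 2 + b ^+ 2], so this quantity is at most the mean of itself and
   1. *)
rewrite Rintegral_cst// [X in fine X]setT_nat mulr1 RintegralD// !RintegralZl//.
rewrite -/a -/b; lra.
Qed.

End laws_on_nat.

(** * Mixtures of binomial laws *)

Section mixed_binomial_moments.
Context {R : realType}.
Implicit Types (nu : probability nat R) (p : {i01 R}).

Let p01 p : (0 : R) <= p%:num <= (1 : R). Proof. by apply/andP; split. Qed.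

Let binomial_pmfE (p : R) l j :
  binomial_pmf l p j = 'C(l, j)%:R * (p ^+ j * (1 - p) ^+ (l - j)).
Proof. by rewrite /binomial_pmf -mulr_natl. Qed.

Lemma sum_binomial_pmf (p : R) l : \sum_(j < l.+1) binomial_pmf l p j = 1.
Proof.
have <- : ((1 - p) + p) ^+ l = 1 by rewrite subrK expr1n.
by rewrite exprDn; apply: eq_bigr => j _; rewrite /binomial_pmf mulrC.
Qed.

(** The absorption identity [j.+1 * 'C(l.+1, j.+1) = l.+1 * 'C(l, j)] reduces the sum to a total
    binomial mass. *)
Lemma binomial_mean (p : R) l :
  \sum_(j < l.+1) j%:R * binomial_pmf l p j = p * l%:R.
Proof.
rewrite big_ord_recl mul0r add0r; case: l => [|l];
  first by rewrite big_ord0 mulr0.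
transitivity (\sum_(j < l.+1) p * l.+1%:R * binomial_pmf l p j); last first.
  by rewrite -mulr_sumr sum_binomial_pmf mulr1.
apply: eq_bigr => j _; rewrite lift0 !binomial_pmfE subSS exprS.
have := mul_bin_diag l.+1 j; rewrite /= => /(congr1 (fun n => n%:R : R)).
rewrite !natrM => H.
transitivity (p * (p ^+ j * (1 - p) ^+ (l - j)) * (j.+1%:R * 'C(l.+1,
  j.+1)%:R)).
  by ring.
by rewrite -H; ring.
Qed.

Lemma mixed_binomial_set1E nu p j : mixed_binomial nu p [set j] =
  (\int[nu]_l (binomial_pmf l p%:num j)%:E)%E.
Proof.
rewrite mixed_binomial_set1 /mixed_binomial_pmf ge0_integral_nat; last first.
  by move=> l; rewrite lee_fin binomial_pmf_ge0.
rewrite [RHS](@nneseries_split _ _ 0%N j); last first.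
  by move=> l _; rewrite mule_ge0// lee_fin binomial_pmf_ge0.
rewrite add0n big_nat big1 ?add0e//.
by move=> l /andP[_ lj]; rewrite /binomial_pmf bin_small// mulr0n mul0e.
Qed.

(** Tonelli over the pairs [(j, l)], the inner sum being a binomial mean. An infinite mean is
    allowed: for [p = 0] the convention [0 * +oo = 0] gives the right value. *)
Lemma mean_mixed_binomial nu p :
  mean (mixed_binomial nu p) = (p%:num%:E * mean nu)%E.
Proof.
have b0 l j : (0 <= (binomial_pmf l p%:num j)%:E)%E by rewrite lee_fin
  binomial_pmf_ge0.
have n0 (j : nat) : (0 <= (j%:R : R)%:E)%E by rewrite lee_fin.
rewrite /mean !ge0_integral_nat//.
transitivity (\sum_(j <oo) \sum_(l <oo)
    ((j%:R * binomial_pmf l p%:num j)%:E * nu [set l]))%E.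
  apply: eq_eseriesr => j _; rewrite [X in (_ * X)%E]mixed_binomial_set1E.
  rewrite ge0_integral_nat// -nneseriesZl; last by move=> l _; exact: mule_ge0.
  by apply: eq_eseriesr => l _; rewrite EFinM muleA.
rewrite nneseries_interchange; last first.
  by move=> j l; rewrite mule_ge0// EFinM mule_ge0.
rewrite -nneseriesZl; last by move=> l _; exact: mule_ge0.
apply: eq_eseriesr => l _; rewrite (nneseries_split 0 l.+1); last first.
  by move=> j _; rewrite mule_ge0// EFinM mule_ge0.
rewrite [X in (_ + X)%E]eseries0 ?adde0; last first.
  by move=> j lj _; rewrite /binomial_pmf bin_small// mulr0n mulr0 mul0e.
rewrite add0n big_mkord -ge0_sume_distrl; last by move=> j _;
  rewrite EFinM mule_ge0.
by rewrite sumEFin binomial_mean EFinM muleA.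
Qed.

Lemma Rintegral_sum d (T : measurableType d) (m : {measure set T -> \bar R})
    (I : Type) (s : seq I) (f : I -> T -> R) :
  (forall i, m.-integrable setT (EFin \o f i)) ->
  \int[m]_x (\sum_(i <- s) f i x) = \sum_(i <- s) \int[m]_x f i x.
Proof.
move=> fi; rewrite /Rintegral sum_fine; last first.
  by move=> i _; exact: integrable_fin_num (fi i).
by rewrite -integral_sum//; congr fine; apply: eq_integral => x _;
  rewrite sumEFin.
Qed.

(** [bonferroni_binomial] integrated against [nu]; finite moments up to order [j + r] make the
    truncated series integrable. *)
Lemma bonferroni_mixed_binomial nu p j r :
  (forall i, (i <= r)%N ->
    (\int[nu]_l (p%:num ^+ (j + i) * (l ^_ (j + i))%:R)%:E < +oo)%E) ->
  0 <= (-1) ^+ r * (\sum_(i < r.+1) (-1) ^+ i / (i`!%:R * j`!%:R) *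
     \int[nu]_l (p%:num ^+ (j + i) * (l ^_ (j + i))%:R)
     - fine (mixed_binomial nu p [set j])).
Proof.
move=> Fi; pose F (i : 'I_r.+1) (l : nat) : R := p%:num ^+ (j + i) * (l ^_ (j +
  i))%:R.
have iF i : nu.-integrable setT (EFin \o F i).
  apply/integrableP; split => //=.
  under eq_integral do rewrite ger0_norm ?mulr_ge0 ?exprn_ge0//.
  by apply: Fi; rewrite -ltnS.
have icF i (c : R) : nu.-integrable setT (EFin \o (fun l => c * F i l)).
  exact: (integrableZl _ c (iF i)).
have ib : nu.-integrable setT (EFin \o (fun l => binomial_pmf l p%:num j)).
  apply: (@integrable_bounded _ _ _ 1) => l.
  (* The bound 1 is rewritten as the sum of all binomial masses, of which this is a term if
     [j <= l], and zero otherwise. *)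
  rewrite ger0_norm ?binomial_pmf_ge0// -(sum_binomial_pmf p%:num l).
  have [jl|lj] := ltnP j l.+1.
    rewrite (bigD1 (Ordinal jl))//= lerDl; apply: sumr_ge0 => k _.
    exact: binomial_pmf_ge0.
  by rewrite /binomial_pmf bin_small// sumr_ge0// => k _;
    exact: binomial_pmf_ge0.
have iS : nu.-integrable setT (EFin \o (fun l =>
    \sum_(i < r.+1) (-1) ^+ i / (i`!%:R * j`!%:R) * F i l)).
  rewrite (_ : _ \o _ = fun l => (\sum_(i < r.+1)
      ((-1) ^+ i / (i`!%:R * j`!%:R) * F i l)%:E)%E).
    by apply: integrable_sum => // i _; exact: icF.
  by apply/funext => l /=; rewrite sumEFin.
rewrite mixed_binomial_set1E -/(Rintegral nu setT _).
under eq_bigr => i _ do rewrite -(RintegralZl _ _ (iF i))//.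
rewrite -(Rintegral_sum _ (fun i => icF i _)) -RintegralB// -RintegralZl//;
  last first.
  exact: (integrableB _ iS ib).
by apply: Rintegral_ge0 => l _; exact: bonferroni_binomial.
Qed.

End mixed_binomial_moments.

(** * Measures on [nat] with prescribed masses *)

Section measure_of_masses.
Context {R : realType}.
Variables (h : nat -> R) (h0 : forall j, 0 <= h j).

Let masses : {measure set nat -> \bar R} :=
  mseries (fun j => mscale (NngNum (h0 j)) (dirac j)) 0.

Let scaled_diracE k U :
  mscale (NngNum (h0 k)) (dirac k) U = ((h k)%:E * (k \in U)%:R%:E)%E.
Proof. by rewrite -diracE. Qed.

Let masses_set1 j : masses [set j] = (h j)%:E.
Proof.
rewrite /masses /= /mseries (nneseriesD1 (n := j))//.
rewrite [X in (X + _)%E]scaled_diracE mem_set// mule1 eseries0 ?adde0//.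
move=> k _ kj; rewrite [LHS]scaled_diracE memNset ?mule0//=.
by move=> kj'; move: kj; rewrite kj' eqxx.
Qed.

Let masses_setT : cvgn (series h) -> masses [set: nat] = (limn (series h))%:E.
Proof.
move=> ch; rewrite -EFin_lim//; apply: congr_lim; apply/funext => n /=.
by rewrite -sumEFin; apply: eq_bigr => j _;
  rewrite [LHS]scaled_diracE mem_set// mule1.
Qed.

Lemma exists_finite_measure : cvgn (series h) ->
  exists mu : {finite_measure set nat -> \bar R}, forall j,
    mu [set j] = (h j)%:E.
Proof.
move=> /masses_setT hT.
have fin : fin_num_fun masses.
  move=> U mU; rewrite ge0_fin_numE// (le_lt_trans (le_measure masses _ _
    (@subsetT _ U)))//.
  - exact: mem_set.
  - exact: mem_set.
  - by rewrite [X in (X < _)%E]hT ltry.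
pose F := @Measure_isFinite.Build _ _ _ (masses : set nat -> \bar R) fin.
pose mu : {finite_measure set nat -> \bar R} := HB.pack (Measure.sort masses) F.
by exists mu => j; exact: masses_set1.
Qed.

Lemma exists_probability : series h @ \oo --> (1 : R) ->
  exists Q : probability nat R, forall j, Q [set j] = (h j)%:E.
Proof.
move=> h1; have ch : cvgn (series h) by apply/cvg_ex; exists 1.
have hT : masses [set: nat] = 1%E by rewrite masses_setT// (cvg_lim _ h1).
(* The total mass is already 1, so normalizing changes no mass and only supplies the probability
   structure; the Dirac law is the fallback value for a degenerate total mass. *)
exists (mnormalize masses (dirac 0%N : probability nat R)) => j.
by rewrite /= /mnormalize hT onee_eq0 /= invr1 mule1 masses_set1.
Qed.

End measure_of_masses.

(** * Triangular arrays *)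

(** A finite limit makes the sums finite from some [n] on, and each non-negative term is bounded by
    its sum. *)
Lemma cvg_sum_fine (R : realType) (k_ : nat -> nat)
    (a : forall n, 'I_(k_ n) -> \bar R) (l : R) :
  (forall n k, (0 <= a n k)%E) ->
  (\sum_(k < k_ n) a n k)%E @[n --> \oo] --> l%:E ->
  (\forall n \near \oo, forall k, a n k \is a fin_num) /\
  \sum_(k < k_ n) fine (a n k) @[n --> \oo] --> l.
Proof.
move=> a0 /fine_cvgP[afin al].
have fin : \forall n \near \oo, forall k, a n k \is a fin_num.
  apply: filterS afin => n afin k; rewrite ge0_fin_numE//.
  apply: (@le_lt_trans _ _ (\sum_(k < k_ n) a n k)%E);
    last by rewrite -ge0_fin_numE// sume_ge0.
  by rewrite (bigD1 k)//= leeDl// sume_ge0.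
split=> //; apply: cvg_trans al; apply: near_eq_cvg.
by apply: filterS fin => n afin' /=; rewrite sum_fine.
Qed.

(** Truncations of consecutive orders enclose the summed mass. First [n] tends to infinity at fixed
    order; a large order then brings both bounds close to [intensity lambda j]. *)
Lemma cvg_sum_mixed_binomial (R : realType) (k_ : nat -> nat)
    (nu : forall n, 'I_(k_ n) -> probability nat R)
    (p : forall n, 'I_(k_ n) -> {i01 R}) (lambda : nat -> R) :
  (forall j, (0 < j)%N ->
    (\sum_(k < k_ n) \int[nu n k]_l ((p n k)%:num ^+ j * (l ^_ j)%:R)%:E)%E
      @[n --> \oo] --> (lambda j)%:E) ->
  (forall j, (0 < j)%N -> cvgn (intensity_series lambda j)) ->
  forall j, (0 < j)%N ->
    \sum_(k < k_ n) fine (mixed_binomial (nu n k) (p n k) [set j])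
      @[n --> \oo] --> intensity lambda j.
Proof.
move=> clambda cint j j0.
pose F n (k : 'I_(k_ n)) (i : nat) (l : nat) : R := (p n k)%:num ^+ i * (l ^_
  i)%:R.
have F0 n k i l : 0 <= @F n k i l by rewrite mulr_ge0// exprn_ge0.
have intF0 i n k : (0 <= \int[nu n k]_l (F n k i l)%:E)%E.
  by apply: integral_ge0 => l _; rewrite lee_fin.
have {}clambda i := cvg_sum_fine (intF0 (j + i)%N) (clambda (j + i)%N (ltn_addr
  i j0)).
pose c i : R := (-1) ^+ i / (i`!%:R * j`!%:R).
pose A n i := \sum_(k < k_ n) \int[nu n k]_l F n k (j + i)%N l.
pose g n := \sum_(k < k_ n) fine (mixed_binomial (nu n k) (p n k) [set j]).
pose T r := \sum_(i < r.+1) c i * lambda (j + i)%N.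
pose Tn n r := \sum_(i < r.+1) c i * A n i.
have cT r : Tn n r @[n --> \oo] --> T r.
  apply: cvg_big => [|i _]; first exact: add_continuous.
  by apply: cvgMl_tmp; exact: (clambda i).2.
have bonf r : \forall n \near \oo, 0 <= (-1) ^+ r * (Tn n r - g n).
  have fin : \forall n \near \oo, forall i : 'I_r.+1, forall k,
      (\int[nu n k]_l (F n k (j + i)%N l)%:E)%E \is a fin_num.
    by apply: filter_forall => i; exact: (clambda i).1.
  apply: filterS fin => n fin.
  have -> : Tn n r - g n = \sum_(k < k_ n) (\sum_(i < r.+1) c i *
      \int[nu n k]_l F n k (j + i)%N l - fine (mixed_binomial (nu n k) (p n k)
        [set j])).
    rewrite sumrB; congr (_ - _); rewrite exchange_big; apply: eq_bigr => i _.
    by rewrite mulr_sumr.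
  rewrite mulr_sumr; apply: sumr_ge0 => k _;
    apply: bonferroni_mixed_binomial => i ir.
  have := fin (Ordinal (ir : (i < r.+1)%N)) k.
  by rewrite ge0_fin_numE.
have cI : T r @[r --> \oo] --> intensity lambda j.
  have H := cvgMl_tmp (a := (j`!%:R)^-1) (cint j j0).
  (* [T r] has [r + 1] terms, hence the partial sum at [r.+1]. *)
  rewrite -cvg_shiftS in H; rewrite (_ : T = fun r =>
    (j`!%:R)^-1 * intensity_series lambda j r.+1); first exact: H.
  apply/funext => r; rewrite /T /intensity_series /series /= big_mkord
    mulr_sumr.
  by apply: eq_bigr => i _; rewrite /c invfM; ring.
apply/cvgrPdist_le => e e0.
have e20 : 0 < e / 2 by rewrite divr_gt0.
have /cvgrPdist_le/(_ _ e20)[r0 _ Hr] := cI.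
(* The even order [r0.*2] bounds [g n] from above, the odd order [r0.*2.+1] from below. *)
have r2 : (r0 <= r0.*2)%N by rewrite -addnn leq_addr.
have H0 := Hr r0.*2 r2; have H1 := Hr r0.*2.+1 (leqW r2).
have /cvgrPdist_le/(_ _ e20) Hn0 := cT r0.*2.
have /cvgrPdist_le/(_ _ e20) Hn1 := cT r0.*2.+1.
have N0 := bonf r0.*2; have N1 := bonf r0.*2.+1.
apply: filterS2 (filterI N0 N1) (filterI Hn0 Hn1) => n [] + + [].
move: H0 H1; rewrite -(signr_odd _ r0.*2) -(signr_odd _ r0.*2.+1) oddS
  odd_double.
rewrite expr0 expr1 mul1r mulN1r -/(g n).
move: (g n) (Tn n _) (Tn n _) (T _) (T _) (intensity _ _) => a b c' t u v.
rewrite !ler_norml; lra.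
Qed.

Section triangular_array.
Context {R : realType}.
Implicit Types (P : probability nat R) (f : nat -> R).

(** Case [J = 1] of [series_tight_dist]: the subtracted partial sum is the term at 0, which
    vanishes. *)
Lemma Rintegral_le_mean P f B : (forall j, `|f j| <= B) -> f 0%N = 0 ->
  (mean P < +oo)%E -> `|\int[P]_x f x| <= B * fine (mean P).
Proof.
move=> fB f0 Poo.
have := series_tight_dist (fine_set1_ge0 P) (fun J => sum_mean_le J Poo) fB
  (ltn0Sn 0).
by rewrite (cvg_lim _ (cvg_series_Rintegral (P := P) fB))// /series /= big_nat1
  f0 mul0r subr0 divr1.
Qed.

Lemma bounded_funP f : bounded_fun f -> exists B, forall j, `|f j| <= B.
Proof.
by move=> [M [_ fM]]; exists (M + 1) => j; apply: fM => //; rewrite ltrDl.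
Qed.

Lemma pgfE P (z : R[i]) : `|z| <= 1 -> pgf P z = gf P z.
Proof.
move=> z1; apply: cvg_lim => //; apply: cvg_complex.
  have Rez j := (ReIm_expr_le1 j z1).1.
  under eq_cvg do rewrite Re_sum; apply: cvg_trans (cvg_series_Rintegral (P :=
    P) Rez).
  apply: near_eq_cvg; near=> n; apply: eq_bigr => j _.
  by case: (z ^+ j) => a b /=; rewrite mul0r subr0 mulrC.
have Imz j := (ReIm_expr_le1 j z1).2.
under eq_cvg do rewrite Im_sum; apply: cvg_trans (cvg_series_Rintegral (P := P)
  Imz).
apply: near_eq_cvg; near=> n; apply: eq_bigr => j _.
by case: (z ^+ j) => a b /=; rewrite mul0r addr0 mulrC.
Unshelve. all: by end_near. Qed.

Lemma weak_cvgP (P_ : nat -> probability nat R) P :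
  (forall f B, (forall j, `|f j| <= B) ->
    \int[P_ n]_x f x @[n --> \oo] --> \int[P]_x f x) ->
  weak_cvg P_ P.
Proof.
move=> H f _ /bounded_funP[B fB].
have E P' : 'E_P'[f]%E = (\int[P']_x f x)%:E.
  rewrite unlock /Rintegral fineK//.
  by apply: integrable_fin_num => //; exact: integrable_bounded fB.
by rewrite E; under eq_cvg do rewrite E; apply: cvg_EFin;
  [near=> n|exact: H fB].
Unshelve. all: by end_near. Qed.

(** * Compound Poisson limit for an array of laws on [nat] *)

Variables (k_ : nat -> nat) (X : forall n, 'I_(k_ n) -> probability nat R).
Variables (l : R) (m : nat -> R).
Hypothesis cvg_mean : (\sum_(k < k_ n) mean (X k))%E @[n --> \oo] --> l%:E.
Hypothesis cvg_mean2 :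
  (\sum_(k < k_ n) (mean (X k)) ^+ 2)%E @[n --> \oo] --> 0%E.
Hypothesis cvg_mass : forall j, (0 < j)%N ->
  \sum_(k < k_ n) fine (X k [set j]) @[n --> \oo] --> m j.

Let a n (k : 'I_(k_ n)) : R := fine (mean (X k)).

Let mean_fin : \forall n \near \oo, forall k : 'I_(k_ n),
  mean (X k) \is a fin_num.
Proof. by case: (cvg_sum_fine (fun n k => mean_ge0 (X k)) cvg_mean). Qed.

Let sum_mean_bound : \forall n \near \oo, \sum_(k < k_ n) a k <= l + 1.
Proof.
have [_ /cvgrPdist_le/(_ 1 ltr01)] := cvg_sum_fine (fun n k => mean_ge0 (X k))
  cvg_mean.
by apply: filterS => n; rewrite ler_norml => /andP[+ _]; rewrite /a; lra.
Qed.

Let cvg_sum_mean2 : \sum_(k < k_ n) a k ^+ 2 @[n --> \oo] --> 0.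
Proof.
have [|_ H] := cvg_sum_fine (l := 0) _ cvg_mean2.
  by move=> n k; rewrite expe_ge0// mean_ge0.
apply: cvg_trans H; apply: near_eq_cvg; apply: filterS mean_fin => n fin /=.
by apply: eq_bigr => k _; rewrite fineM// expr2.
Qed.

(* The mass at 0 grows with [k_ n]; it is discarded because the test functions
   [z ^+ j - 1] vanish at [j = 0]. *)
Let mass n j : R := if j == 0%N then 0 else \sum_(k < k_ n) fine (X k [set j]).

Let mass_lim j : R := if j == 0%N then 0 else m j.

Let mass_ge0 n j : 0 <= mass n j.
Proof.
by rewrite /mass; case: ifP => // _; apply: sumr_ge0 => k _;
  exact: fine_set1_ge0.
Qed.

Let mass_cvg j : mass n j @[n --> \oo] --> mass_lim j.
Proof.
rewrite /mass /mass_lim; case: ifP => [_|/negbT]; first exact: cvg_cst.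
by rewrite -lt0n => /cvg_mass.
Qed.

Let mass_bound : \forall n \near \oo,
  forall J, \sum_(0 <= j < J) j%:R * mass n j <= l + 1.
Proof.
apply: filterS2 mean_fin sum_mean_bound => n fin le J; apply: le_trans le.
rewrite (_ : \sum_(0 <= j < _) _ =
    \sum_(k < k_ n) \sum_(0 <= j < J) j%:R * fine (X k [set j])).
  apply: ler_sum => k _; apply: sum_mean_le.
  by rewrite -ge0_fin_numE ?mean_ge0.
rewrite exchange_big; apply: eq_bigr => j _; rewrite /mass; case: eqP => [->|_].
  by rewrite mul0r big1// => k _; rewrite mul0r.
by rewrite mulr_sumr.
Qed.

Let sum_Rintegral f B n : (forall j, `|f j| <= B) -> f 0%N = 0 ->
  \sum_(k < k_ n) \int[X k]_x f x = limn (series (fun j => f j * mass n j)).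
Proof.
move=> fB f0; apply/esym/cvg_lim => //.
rewrite (_ : series _ =
    fun N => \sum_(k < k_ n) series (fun j => f j * fine (X k [set j])) N).
  apply: cvg_big => [|k _]; first exact: add_continuous.
  exact: cvg_series_Rintegral fB.
apply/funext => N; rewrite /series/= exchange_big; apply: eq_bigr => j _.
rewrite /mass; case: eqP => [->|_]; last by rewrite mulr_sumr.
by rewrite mulr0 big1// => k _; rewrite f0 mul0r.
Qed.

(** The sum of [mass_lim j * (z ^+ j - 1)] over [j], by components; the 1 affects the real part
    only. *)
Let exponent (z : R[i]) : R[i] :=
  (limn (series (fun j => (complex.Re (z ^+ j) - 1) * mass_lim j))
   +i* limn (series (fun j => complex.Im (z ^+ j) * mass_lim j)))%C.

(** [cvg_prod_cexp] with [w = gf - 1], whose components integrate functions vanishing at 0: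
    [tight_cvg] gives the limits of their sums, and the squared means control their squares. *)
Let cvg_gf (z : R[i]) : `|z| <= 1 ->
  complex.Re (gf (nconv (@X n)) z) @[n --> \oo] --> complex.Re (cexp (exponent
    z)) /\
  complex.Im (gf (nconv (@X n)) z) @[n --> \oo] --> complex.Im (cexp (exponent
    z)).
Proof.
move=> z1; pose w n (k : 'I_(k_ n)) := gf (X k) z - 1.
have Rez j := (ReIm_expr_le1 j z1).1; have Imz j := (ReIm_expr_le1 j z1).2.
have Re2 j : `|complex.Re (z ^+ j) - 1| <= 2.
  by rewrite (le_trans (ler_normB _ _))// normr1 -[leRHS](@natrD R 1 1) lerD.
have Im2 j : `|complex.Im (z ^+ j)| <= 2 by rewrite (le_trans (Imz j))// ler1n.
have Re0 : complex.Re (z ^+ 0) - 1 = 0 by rewrite expr0 /= subrr.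
have Im0 : complex.Im (z ^+ 0) = 0 by rewrite expr0.
have Rew n (k : 'I_(k_ n)) : complex.Re (w n k) =
  \int[X k]_x (complex.Re (z ^+ x) - 1).
  rewrite RintegralB//; [|exact: integrable_bounded Rez
    |by apply: integrable_bounded => j; exact: lexx].
  by rewrite Rintegral_cst// [X in fine X]probability_setT mulr1.
have Imw n (k : 'I_(k_ n)) : complex.Im (w n k) =
  \int[X k]_x complex.Im (z ^+ x).
  by rewrite /w /= subr0.
have gfE n : gf (nconv (@X n)) z = \prod_(k < k_ n) (1 + w n k).
  by rewrite gf_nconv//; apply: eq_bigr => k _; rewrite /w addrC subrK.
have [_ _ cRe] := tight_cvg mass_ge0 mass_cvg mass_bound Re2.
have [_ _ cIm] := tight_cvg mass_ge0 mass_cvg mass_bound Im2.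
have sq : \sum_(k < k_ n) (complex.Re (w n k) ^+ 2 + complex.Im (w n k) ^+ 2)
    @[n --> \oo] --> 0.
  (* Each component is at most [2 * a k] in absolute value, so the two squares add up to at most
     [8 * a k ^+ 2]. *)
  have c8 : 8 * \sum_(k < k_ n) a k ^+ 2 @[n --> \oo] --> 0.
    by rewrite -[X in _ --> X](mulr0 8); exact: cvgMl_tmp.
  apply: (squeeze_cvgr _ (cvg_cst 0) c8); apply: filterS mean_fin => n fin.
  rewrite sumr_ge0 => [|k _]; last by rewrite addr_ge0 ?sqr_ge0.
  rewrite mulr_sumr; apply: ler_sum => k _.
  have moo : (mean (X k) < +oo)%E by rewrite -ge0_fin_numE ?mean_ge0.
  have := Rintegral_le_mean Re2 Re0 moo; have := Rintegral_le_mean Im2 Im0 moo.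
  rewrite -Rew -Imw -/(a k); set u := complex.Re _; set v := complex.Im _.
  have a0 : 0 <= a k by exact/fine_ge0/mean_ge0.
  have sqr_le x : `|x| <= 2 * a k -> x ^+ 2 <= (2 * a k) ^+ 2.
    by move=> xa; rewrite -[leLHS]real_normK ?num_real// ler_pXn2r ?nnegrE
      ?mulr_ge0.
  move=> /sqr_le + /sqr_le; rewrite exprMn. lra.
under eq_cvg do rewrite gfE.
under [X in _ /\ X]eq_cvg do rewrite gfE.
apply: cvg_prod_cexp => //.
- by move=> n k; rewrite /w addrC subrK normc_gf_le1.
- by under eq_cvg do rewrite (eq_bigr _ (fun k _ => Rew _ k)) (sum_Rintegral _
  Re2 Re0).
- by under eq_cvg do rewrite (eq_bigr _ (fun k _ => Imw _ k)) (sum_Rintegral _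
  Im2 Im0).
Qed.

Let q n j : R := fine (nconv (@X n) [set j]).

Let q_lim j := limn (q^~ j).

(** [cvg_gf] at real points of the interval from 0 to 1 supplies the hypothesis of [cvg_coef]. *)
Let q_cvg j : q n j @[n --> \oo] --> q_lim j.
Proof.
apply: cvg_coef => [n i|x /andP[x0 x1]].
  rewrite fine_set1_ge0 -lee_fin fine_set1K; exact: probability_le1.
have xc1 : `|x%:C%C : R[i]| <= 1.
  by rewrite normc_def /= expr0n addr0 sqrtr_sqr gtr0_norm// lecR ltW.
have xj j' : `|x ^+ j'| <= 1.
  by rewrite ger0_norm ?exprn_ge0 ?exprn_ile1// ltW.
have [cx _] := cvg_gf xc1.
apply/cvg_ex; exists (complex.Re (cexp (exponent x%:C%C))).
apply: cvg_trans cx; apply: near_eq_cvg; near=> n.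
apply/esym/cvg_lim => //.
have -> : complex.Re (gf (nconv (@X n)) x%:C%C) = \int[nconv (@X n)]_i (x ^+ i).
  by apply: eq_Rintegral => i _; rewrite -rmorphXn.
rewrite (_ : (fun _ => _) = (fun j => x ^+ j * fine (nconv (@X n) [set j]))).
  exact: cvg_series_Rintegral xj.
by apply/funext => i; rewrite mulrC.
Unshelve. all: by end_near. Qed.

Let q_bound : \forall n \near \oo,
  forall J, \sum_(0 <= j < J) j%:R * q n j <= l + 1.
Proof.
apply: filterS2 mean_fin sum_mean_bound => n fin le J; apply: le_trans le.
have -> : \sum_(k < k_ n) a k = fine (mean (nconv (@X n))).
  by rewrite mean_nconv sum_fine// => k _; exact: fin.
apply: sum_mean_le; rewrite mean_nconv; apply: lte_sum_pinfty => k _.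
by rewrite -ge0_fin_numE ?mean_ge0.
Qed.

Lemma cvg_nconv_compound_poisson :
  exists mu : {finite_measure set nat -> \bar R},
    [/\ mu [set 0%N] = 0%E,
        forall j, (0 < j)%N -> mu [set j] = (m j)%:E
      & exists2 Q : probability nat R, compound_poisson mu Q &
          weak_cvg (fun n => nconv (@X n)) Q].
Proof.
have b1 (j : nat) : `|1 : R| <= 1 by rewrite normr1.
have q0 n j : 0 <= q n j by exact: fine_set1_ge0.
(* The limit masses inherit the first-moment bound, hence are summable, and [mu] is finite. *)
have [mass_lim0 massC _] := tight_cvg mass_ge0 mass_cvg mass_bound b1.
have mass_summable := series_tight_cvg mass_lim0 massC b1.
have {mass_summable} mass_summable : cvgn (series mass_lim).
  by rewrite (_ : mass_lim = fun j => 1 * mass_lim j)//; apply/funext => j;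
    rewrite mul1r.
have [mu muE] := exists_finite_measure mass_lim0 mass_summable.
have tight f B (fB : forall j, `|f j| <= B) :
    \int[nconv (@X n)]_x f x @[n --> \oo] --> limn (series (fun j => f j *
      q_lim j)).
  have [_ _] := tight_cvg q0 q_cvg q_bound fB.
  apply: cvg_trans; apply: near_eq_cvg; near=> n.
  by rewrite (cvg_lim _ (cvg_series_Rintegral fB)).
have [q_lim0 qC _] := tight_cvg q0 q_cvg q_bound b1.
(* No mass escapes to infinity: the integrals of the constant 1 equal 1 for every [n] and tend to
   the sum of [q_lim]. *)
have q_sum : series q_lim @ \oo --> (1 : R).
  rewrite [X in series X](_ : _ = fun j => 1 * q_lim j); last first.
    by apply/funext => j; rewrite mul1r.
  suff lim1 : limn (series (fun j => 1 * q_lim j)) = 1.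
    by rewrite -[X in _ --> X]lim1; exact: series_tight_cvg qC b1.
  rewrite -(cvg_lim _ (tight (fun=> 1) 1 b1))//; apply: cvg_lim => //.
  under eq_cvg do rewrite Rintegral_cst// [X in fine X]probability_setT mulr1.
  exact: cvg_cst.
have [Q QE] := exists_probability q_lim0 q_sum.
have cQ f B (fB : forall j, `|f j| <= B) :
    \int[nconv (@X n)]_x f x @[n --> \oo] --> \int[Q]_x f x.
  rewrite -(cvg_lim _ (cvg_series_Rintegral (P := Q) fB))//.
  rewrite [X in series X](_ : _ = fun j => f j * q_lim j);
    first exact: tight fB.
  by apply/funext => j; rewrite QE.
exists mu; split; first by rewrite muE.
  by move=> j j0; rewrite muE /mass_lim gtn_eqF.
exists Q; last exact: weak_cvgP.
(* The generating functions of the convolutions tend to that of [Q] by [cQ] and to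
   [cexp (exponent z)] by [cvg_gf]; uniqueness of limits identifies the two. *)
move=> z z1; have Rez j := (ReIm_expr_le1 j z1).1;
  have Imz j := (ReIm_expr_le1 j z1).2.
rewrite pgfE//; have [cRe cIm] := cvg_gf z1.
transitivity (cexp (exponent z)).
  apply/eqP; rewrite eq_complex; apply/andP; split; apply/eqP.
    exact: (cvg_unique _ (cQ _ _ Rez) cRe).
  exact: (cvg_unique _ (cQ _ _ Imz) cIm).
congr cexp; apply/esym; apply: (@cvg_lim R[i]^o) => //.
have Re2 j : `|complex.Re (z ^+ j) - 1| <= 2.
  by rewrite (le_trans (ler_normB _ _))// normr1 -[leRHS](@natrD R 1 1) lerD.
(* [compound_poisson] sums over [i.+1]; the dropped term at 0 vanishes because [mass_lim 0 = 0]. *)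
have shift f : cvgn (series (fun j => f j * mass_lim j)) ->
    \sum_(0 <= j < n) f j.+1 * mass_lim j.+1 @[n --> \oo] -->
    limn (series (fun j => f j * mass_lim j)).
  move=> cf; rewrite -cvg_shiftS in cf; apply: cvg_trans cf;
    apply: near_eq_cvg; near=> n.
  by rewrite /series/= big_nat_recl// /mass_lim/= mulr0 add0r.
apply: cvg_complex.
  have := shift _ (series_tight_cvg mass_lim0 massC Re2).
  apply: cvg_trans; apply: near_eq_cvg; near=> n.
  rewrite Re_sum; apply: eq_bigr => j _; rewrite muE.
  by case: (z ^+ j.+1) => u v /=; rewrite mul0r subr0 mulrC.
have := shift _ (series_tight_cvg mass_lim0 massC Imz).
apply: cvg_trans; apply: near_eq_cvg; near=> n.
rewrite Im_sum; apply: eq_bigr => j _; rewrite muE.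
by case: (z ^+ j.+1) => u v /=; rewrite mul0r addr0 subr0 mulrC.
Unshelve. all: by end_near. Qed.

End triangular_array.

(** * From random variables to their laws *)

Lemma integral_ffact_distribution (R : realType) d (T : measurableType d)
    (Pr : probability T R) (X : {RV Pr >-> nat}) (p : {i01 R}) j :
  (\int[distribution Pr X]_l (p%:num ^+ j * (l ^_ j)%:R)%:E =
    (p%:num ^+ j)%:E * factorial_moment X j)%E.
Proof.
under eq_integral do rewrite EFinM.
rewrite ge0_integralZl_EFin ?exprn_ge0//.
by rewrite ge0_integral_distribution// /factorial_moment unlock.
Qed.

Lemma mean_distribution (R : realType) d (T : measurableType d)
    (Pr : probability T R) (X : {RV Pr >-> nat}) :
  mean (distribution Pr X) = ('E_Pr[fun w => (X w)%:R])%E.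
Proof. by rewrite /mean ge0_integral_distribution// unlock. Qed.

Theorem theorem6 (R : realType) (k_ : nat -> nat)
  (d : forall n : nat, 'I_(k_ n) -> measure_display)
  (Omega : forall (n : nat) (k : 'I_(k_ n)), measurableType (d n k))
  (P : forall (n : nat) (k : 'I_(k_ n)), probability (Omega n k) R)
  (zeta : forall (n : nat) (k : 'I_(k_ n)), {RV (P n k) >-> nat})
  (p : forall n : nat, 'I_(k_ n) -> {i01 R})
  (lambda : nat -> R) :
  (forall n, (0 < k_ n)%N) ->
  (forall j, (0 < j)%N -> 0 <= lambda j) ->
  (forall j, (0 < j)%N ->
    (\sum_(k < k_ n) ((p n k)%:num ^+ j)%:E * factorial_moment (zeta n k) j)%E
      @[n --> \oo] --> (lambda j)%:E) ->
  (forall j, (0 < j)%N -> cvgn (intensity_series lambda j)) ->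
  ((\sum_(k < k_ n)
      ((p n k)%:num%:E * 'E_(P n k)[fun w => (zeta n k w)%:R]) ^+ 2)%E
    @[n --> \oo] --> 0%E) ->
  exists mu : {finite_measure set nat -> \bar R},
    [/\ mu [set 0%N] = 0%E,
        forall j, (0 < j)%N -> mu [set j] = (intensity lambda j)%:E
      & exists2 Q : probability nat R, compound_poisson mu Q &
          weak_cvg (fun n => nconv (fun k : 'I_(k_ n) =>
            mixed_binomial (distribution (P n k) (zeta n k)) (p n k))) Q].
Proof.
move=> _ _ clambda cint cmean2.
pose nu n (k : 'I_(k_ n)) : probability nat R := distribution (P n k) (zeta n
  k).
pose X n (k : 'I_(k_ n)) : probability nat R := mixed_binomial (nu n k) (p n k).
have meanX n k : mean (@X n k) =
    ((p n k)%:num%:E * 'E_(P n k)[fun w => (zeta n k w)%:R])%E.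
  by rewrite [LHS]mean_mixed_binomial mean_distribution.
(* The mean of each mixture is [p] times the mean of [zeta], a first factorial moment, so the summed
   means tend to [lambda 1], and hypothesis (ii) concerns exactly their squares. *)
apply: (@cvg_nconv_compound_poisson _ _ X (lambda 1%N)).
- have := clambda 1%N isT; apply: cvg_trans; apply: near_eq_cvg; near=> n.
  apply: eq_bigr => k _; rewrite meanX expr1 /factorial_moment.
  by congr (_ * 'E_(_)[_])%E; apply/funext => w; rewrite ffactn1.
- by under eq_cvg do under eq_bigr do rewrite meanX.
- apply: (@cvg_sum_mixed_binomial _ _ nu p) cint => j j0.
  under eq_cvg do under eq_bigr do rewrite integral_ffact_distribution.
  exact: clambda.
Unshelve. all: by end_near. Qed.
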